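(* Let $(F_n)_{n\ge0}$ and $(L_n)_{n\ge0}$ be the Fibonacci and Lucas sequences. For integers $2\le b\le 10$, consider the equation $$L_n = F_m\cdot b^d + L_k$$ in non-negative integers $n,k$ and positive integer $m\ge1$, where $d$ is the number of digits of $L_k$ written in base $b$. Then the only solutions $(n,m,k,b,d)$ are: - $b=2$: $(2,1,1,2,1)$, $(2,2,1,2,1)$, $(4,1,2,2,2)$, $(4,2,2,2,2)$, $(4,4,1,2,1)$, $(5,3,2,2,2)$, $(5,5,1,2,1)$, $(8,5,4,2,3)$; - $b=3$: $(3,1,1,3,1)$, $(3,2,1,3,1)$, $(4,3,1,3,1)$, $(5,4,0,3,1)$, $(9,6,3,3,2)$; - $b=4$: $(4,1,2,4,1)$, $(4,2,2,4,1)$, $(5,3,2,4,1)$; - $b=5$: $(4,1,0,5,1)$, $(4,2,0,5,1)$, $(5,3,1,5,1)$, $(6,4,2,5,1)$, $(7,5,3,5,1)$; - $b=6$: $(4,1,1,6,1)$, $(4,2,1,6,1)$, $(8,1,5,6,2)$, $(8,2,5,6,2)$; - $b=7$: $(5,1,3,7,1)$, $(5,2,3,7,1)$, $(6,3,3,7,1)$; - $b=8$: $(5,1,2,8,1)$, $(5,2,2,8,1)$, $(6,3,0,8,1)$, $(8,5,4,8,1)$, $(14,7,5,8,2)$; - $b=9$: $(5,1,0,9,1)$, $(5,2,0,9,1)$, $(7,4,0,9,1)$, $(8,5,0,9,1)$, $(9,6,3,9,1)$; - $b=10$: $(5,1,1,10,1)$, $(5,2,1,10,1)$. In particular, for $b=10$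 the only Lucas number satisfying the equation is $L_5 = 10\cdot F_1 + L_1 = 10\cdot F_2+L_1 = 11$.
   Context: $F_0=0$, $F_1=1$, $F_{n+2}=F_{n+1}+F_n$; $L_0=2$, $L_1=1$, $L_{n+2}=L_{n+1}+L_n$. The number of base-$b$ digits of a positive integer $N$ is $\lfloor \log_b N\rfloor+1$. *)

(* Defs.v *)
From mathcomp Require Import all_boot.
Set Implicit Arguments. Unset Strict Implicit. Unset Printing Implicit Defensive.

Fixpoint fib (n : nat) : nat :=
  match n with
  | 0 => 0
  | 1 => 1
  | (S ((S p) as q)) => fib q + fib p
  end.

Fixpoint lucas (n : nat) : nat :=
  match n with
  | 0 => 2
  | 1 => 1
  | (S ((S p) as q)) => lucas q + lucas p
  end.

(* number of base-b digits of N >= 1: floor(log_b N) + 1.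
   trunc_log b N is the largest e with b ^ e <= N (for b >= 2, N >= 1). *)
Definition ndigits (b N : nat) : nat := (trunc_log b N).+1.

Definition solutions : seq (nat * nat * nat * nat * nat) :=
  [:: (2,1,1,2,1); (2,2,1,2,1); (4,1,2,2,2); (4,2,2,2,2); (4,4,1,2,1);
      (5,3,2,2,2); (5,5,1,2,1); (8,5,4,2,3);
      (3,1,1,3,1); (3,2,1,3,1); (4,3,1,3,1); (5,4,0,3,1); (9,6,3,3,2);
      (4,1,2,4,1); (4,2,2,4,1); (5,3,2,4,1);
      (4,1,0,5,1); (4,2,0,5,1); (5,3,1,5,1); (6,4,2,5,1); (7,5,3,5,1);
      (4,1,1,6,1); (4,2,1,6,1); (8,1,5,6,2); (8,2,5,6,2);
      (5,1,3,7,1); (5,2,3,7,1); (6,3,3,7,1);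
      (5,1,2,8,1); (5,2,2,8,1); (6,3,0,8,1); (8,5,4,8,1); (14,7,5,8,2);
      (5,1,0,9,1); (5,2,0,9,1); (7,4,0,9,1); (8,5,0,9,1); (9,6,3,9,1);
      (5,1,1,10,1); (5,2,1,10,1)].

(* Main.v *)
(* Put [j = n - m]. As [L_k < b^d <= b L_k], [j] is [k] up to a constant, and
   [5 F_m F_j = L_(m+j) - (-1)^m L_(j-m)] turns the equation into
   [F_m (b^d - 5 F_j) = (-1)^m L_(j-m) - L_k], whence [m <= j + k + 2].
   Modulo [F_m] every Lucas number is up to sign one of [L_0 .. L_m], with an
   index of the same parity; so for [m > 8], [F_m | L_n - L_k] forces
   [n = k mod 2]. In that case [L_n - L_k] divides [5 F_(n+k) F_(n-k)], and
   lifting the exponent shows that the power of a prime [p] dividing [F_N] is at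
   most [p^c N]: so [b^d] is quadratic in [n = O(d)], and [d] is bounded.
   If [m <= 8] and [n - k] is odd then [n - k] is bounded too, and congruences
   exclude all large [d]. For the remaining [b], [d], [k], [j], the sequence
   [L_(m+j) - F_m b^d] in [m] satisfies the Fibonacci recurrence and is scanned
   for the value [L_k]. *)
From Stdlib Require Import ZArith.
Require Import Defs.
From mathcomp Require Import all_boot.
From mathcomp Require Import zify ring.

(** * Addition formulas and product identities for Fibonacci and Lucas numbers *)

Lemma fibSS n : fib n.+2 = fib n.+1 + fib n. Proof. by []. Qed.
Lemma lucasSS n : lucas n.+2 = lucas n.+1 + lucas n. Proof. by []. Qed.
Arguments fib : simpl never.
Arguments lucas : simpl never.

Lemma fib0 : fib 0 = 0. Proof. by []. Qed.
Lemma fib1 : fib 1 = 1. Proof. by []. Qed.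
Lemma lucas0 : lucas 0 = 2. Proof. by []. Qed.
Lemma lucas1 : lucas 1 = 1. Proof. by []. Qed.

Lemma nat_ind2 (P : nat -> Prop) :
  P 0 -> P 1 -> (forall n, P n -> P n.+1 -> P n.+2) -> forall n, P n.
Proof.
move=> P0 P1 PS n; suff: P n /\ P n.+1 by case.
by elim: n => [|n [IH1 IH2]]; split=> //; apply: PS.
Qed.

Lemma lucas_fib n : lucas n + fib n = 2 * fib n.+1.
Proof.
elim/nat_ind2: n => [||n IH1 IH2] //.
by move: (fibSS n) (fibSS n.+1) (lucasSS n); lia.
Qed.

Lemma fibD m n : fib (m + n).+1 = fib m.+1 * fib n.+1 + fib m * fib n.
Proof.
elim/nat_ind2: n => [||n IH1 IH2].
- by rewrite addn0 fib0 fib1 muln0 addn0 muln1.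
- by rewrite addn1 fibSS fibSS fib0 fib1 addn0 !muln1.
- have -> : fib (m + n.+2).+1 = fib (m + n.+1).+1 + fib (m + n).+1.
    by rewrite !addnS fibSS.
  by rewrite IH2 IH1 (fibSS n.+1) (fibSS n); ring.
Qed.

Lemma lucasD m n :
  lucas (m + n).+1 = fib m.+1 * lucas n.+1 + fib m * lucas n.
Proof.
elim/nat_ind2: m => [||m IH1 IH2].
- by rewrite add0n fib0 fib1; ring.
- by rewrite add1n !lucasSS fibSS fib0 fib1; ring.
- have -> : lucas (m.+2 + n).+1 = lucas (m.+1 + n).+1 + lucas (m + n).+1.
    by rewrite !addSn lucasSS.
  by rewrite IH2 IH1 (fibSS m.+1) (fibSS m); ring.
Qed.

(** Cassini's identity [F_(n+1)^2 - F_(n+1) F_n - F_n^2 = (-1)^n]; the booleans, read as 0 or 1,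
    keep the sign inside [nat]. *)
Lemma cassini n :
  fib n.+1 ^ 2 + odd n = fib n.+1 * fib n + fib n ^ 2 + ~~ odd n.
Proof.
elim: n => [|n IH] //; rewrite [odd n.+1]/= fibSS negbK.
by move: IH; rewrite !expnS !expn0 !muln1; case: (odd n) => /=; nia.
Qed.

Lemma fib_gt0 n : 0 < n -> 0 < fib n.
Proof.
case: n => // n _; elim/nat_ind2: n => [||n IH1 IH2] //; rewrite fibSS; lia.
Qed.

Lemma lucas_gt0 n : 0 < lucas n.
Proof. by elim/nat_ind2: n => [||n IH1 IH2] //; rewrite lucasSS; lia. Qed.

Lemma fibDs m n : fib (m + n) + fib m * fib n =
  fib m * fib n.+1 + fib m.+1 * fib n.
Proof.
case: n => [|n]; first by rewrite addn0 fib0 fib1; ring.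
by rewrite addnS fibD (fibSS n); ring.
Qed.

(** [L_(r+2s) - (-1)^s L_r = 5 F_(r+s) F_s]: the addition formulas reduce everything to indices [r],
    [r+1], [s], [s+1], and Cassini at [s], times [L_r], supplies the sign. *)
Lemma lucas_sub_fib r s : lucas (r + s + s) + odd s * lucas r =
  5 * fib (r + s) * fib s + ~~ odd s * lucas r.
Proof.
have Hc := congr1 (muln (lucas r)) (cassini s).
have L1 := lucas_fib r; have L2 := lucas_fib (r + s + s).
have D1 := fibD (r + s) s; have D2 := fibDs (r + s) s.
have D3 := fibD r s; have D4 := fibDs r s.
move: Hc L1 L2 D1 D2 D3 D4; rewrite !expnS !expn0 !muln1.
set z := fib (r + s); set w := fib (r + s).+1.
set a := fib r; set c := fib r.+1; set x := fib s; set y := fib s.+1.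
move: (fib (_ + _)) (fib _.+1) (lucas r) (lucas _) => X Y l L.
clearbody z w a c x y.
case: (odd s) => /= Hc L1 L2 D1 D2 D3 D4.
all: have Ez : z = a * y + c * x - a * x by lia.
all: have : z + a * x = a * y + c * x by lia.
all: nia.
Qed.

Lemma lucas_sub_lucas r s : odd s ->
  lucas (r + s + s) = lucas (r + s) * lucas s + lucas r.
Proof.
move=> os.
have Hc := congr1 (muln (lucas r)) (cassini s).
have L1 := lucas_fib r; have L2 := lucas_fib (r + s + s).
have L3 := lucas_fib (r + s); have L4 := lucas_fib s.
have D1 := fibD (r + s) s; have D2 := fibDs (r + s) s.
have D3 := fibD r s; have D4 := fibDs r s.
move: Hc L1 L2 L3 L4 D1 D2 D3 D4; rewrite !expnS !expn0 !muln1 os.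
set z := fib (r + s); set w := fib (r + s).+1.
set a := fib r; set c := fib r.+1; set x := fib s; set y := fib s.+1.
move: (fib (_ + _)) (fib _.+1) (lucas r) (lucas (r + s + s)) (lucas s)
  (lucas (r + s)) => X Y l L l' L'.
clearbody z w a c x y => /= Hc L1 L2 L3 L4 D1 D2 D3 D4.
have El : l' = 2 * y - x by lia.
have EL : L' = 2 * w - z by lia.
have Ez : z = a * y + c * x - a * x by lia.
have : z + a * x = a * y + c * x by lia.
nia.
Qed.

Lemma fib_double n : fib (n + n) = fib n * lucas n.
Proof.
by move: (fibDs n n) (lucas_fib n); nia.
Qed.

Lemma leq_fib m n : m <= n -> fib m <= fib n.
Proof.
elim: n => [|n IH]; first by rewrite leqn0 => /eqP->.
rewrite leq_eqVlt => /orP[/eqP-> //|/IH h]; apply: leq_trans h _.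
by case: n {IH} => // n; rewrite fibSS leq_addr.
Qed.

(** [1 < n] excludes the descent from [L_0 = 2] to [L_1 = 1]. *)
Lemma ltn_lucas m n : 1 < n -> m < n -> lucas m < lucas n.
Proof.
elim: n => [|[|[|n]] IH] // _; first by case: m {IH} => [|[|m]].
move: (lucas_gt0 n.+1) (lucasSS n.+1) => h e; rewrite leq_eqVlt.
move=> /orP[/eqP[->]|]; first by lia.
by rewrite ltnS => /IH => /(_ isT); lia.
Qed.

Lemma leq_lucas m n : 1 < n -> m <= n -> lucas m <= lucas n.
Proof.
move=> n1; rewrite leq_eqVlt => /orP[/eqP-> //|h].
exact/ltnW/ltn_lucas.
Qed.

(** * Lucas numbers modulo [F_m] and the parity of their indices *)

(* [L_(m+s)] is [+/- L_|m-s|] modulo [F_m], and [m + s], [|m - s|] have the same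
   parity, so reflecting at [m] brings the index down to at most [m]. *)
Lemma lucas_mod_fib m n : 0 < m ->
  exists r, exists q s : Z, [/\ r <= m, odd r = odd n, (s * s = 1)%Z &
    (Z.of_nat (lucas n) = q * Z.of_nat (fib m) + s * Z.of_nat (lucas r))%Z].
Proof.
move=> m0; elim/ltn_ind: n => n IH.
have [nm|mn] := leqP n m; first by exists n, 0%Z, 1%Z; split=> //; lia.
have [n2m|mn2] := leqP n (2 * m).
  exists (2 * m - n), (5 * Z.of_nat (fib (n - m)))%Z,
    (if odd (n - m) then -1 else 1)%Z.
  have := lucas_sub_fib (2 * m - n) (n - m).
  have -> : 2 * m - n + (n - m) = m by lia.
  have -> : m + (n - m) = n by lia.
  by case: ifP => o H; split; lia.
have lt : n - 2 * m < n by lia.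
have [r [q [s [rm orn s1 E]]]] := IH _ lt.
have := lucas_sub_fib (n - 2 * m) m.
have -> : n - 2 * m + m + m = n by lia.
move=> H; exists r, (5 * Z.of_nat (fib (n - 2 * m + m)) + (if odd m then - q else q))%Z,
  (if odd m then - s else s)%Z.
case: ifP H => o H; split; lia.
Qed.

(** For [i > 4], [F_i] lies strictly between [L_(i-2)] and [L_(i-1)]. *)
Lemma lucas_neq_fib i s : 4 < i -> fib i <> lucas s.
Proof.
case: i => [|[|[|[|[|i]]]]] // _ E.
have [h|h] := leqP s i.+3.
  have := leq_lucas s i.+3 isT h.
  move: (lucas_fib i.+3) (fibSS i.+3) (fibSS i.+2) (fibSS i.+1) (fib_gt0 i.+1).
  lia.
have := leq_lucas i.+4 s _ h.
move: (lucas_fib i.+4) (fibSS i.+4) (fibSS i.+3) (fibSS i.+2) (fib_gt0 i.+3).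
lia.
Qed.

(** For [r > 1] the left side lies strictly between 0 and [4 F_m], so [Q] is 1, 2 or 3; then either
    the sizes disagree or [L_s] would be a Fibonacci number. *)
Lemma lucas_comb_mod_fib m r s (Q e : Z) : 8 < m -> s < r <= m ->
  odd r != odd s -> (e * e = 1)%Z ->
  (Z.of_nat (lucas r) + e * Z.of_nat (lucas s) <> Q * Z.of_nat (fib m))%Z.
Proof.
move=> m8 /andP[sr rm] o e1 E.
have {}e1 : (e = 1 \/ e = -1)%Z by nia.
have [r1|r1] := leqP r 1.
  have F8 : fib 6 <= fib m by apply: leq_fib; lia.
  have {}F8 : 8 <= fib m by [].
  have [Er Es] : r = 1 /\ s = 0 by lia.
  move: E; rewrite Er Es lucas1 lucas0.
  by have [q|[q|q]] : (Q < 0 \/ Q = 0 \/ 0 < Q)%Z by [lia]; nia.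
have H2 : lucas s < lucas r by apply: ltn_lucas.
have H3 : lucas r <= lucas m by apply: leq_lucas; lia.
have S3 : s <= m - 3 -> lucas s <= lucas (m - 3) by apply: leq_lucas; lia.
have S4 : s <= m - 4 -> lucas s <= lucas (m - 4) by apply: leq_lucas; lia.
have R3 : r <= m - 3 -> lucas r <= lucas (m - 3) by apply: leq_lucas; lia.
have C : [\/ r = m /\ (s = m - 1 \/ s <= m - 3),
  r = m - 1 /\ (s = m - 2 \/ s <= m - 4), r = m - 2 /\ s <= m - 3
  | r <= m - 3 /\ s <= m - 4].
  have [h|[h|[h|h]]] : r = m \/ r = m - 1 \/ r = m - 2 \/ r <= m - 3 by lia.
  - by constructor 1; lia.
  - by constructor 2; lia.
  - by constructor 3; lia.
  - by constructor 4; lia.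
case: m m8 rm E H3 S3 S4 R3 C => [|[|[|[|[|m]]]]] // m8 rm E.
rewrite !subSS !subn0 => H3 S3 S4 R3 C.
(* Before the shift by 5 this index was [m - 4]: [m > 8] puts it above 4. *)
have N1 := @lucas_neq_fib m.+1 s; have N2 := @lucas_neq_fib m.+2 s.
have N3 := @lucas_neq_fib m.+3 s; have N4 := @lucas_neq_fib m.+4 s.
move: (fibSS m) (fibSS m.+1) (fibSS m.+2) (fibSS m.+3) (lucas_fib m.+4)
  (lucas_fib m.+3) (lucas_fib m.+2) (lucas_fib m.+1) (lucas_fib m)
  (lucasSS m.+3) (@fib_gt0 m) (@fib_gt0 m.+1) (lucas_gt0 s).
move=> E1 E2 E3 E4 L4 L3 L2 L1 L0 E5 P0 P1 P2.
have Q1 : (0 < Q < 4)%Z.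
  split.
    suff: (0 < Q * Z.of_nat (fib m.+4.+1))%Z by nia.
    lia.
  suff: (Q * Z.of_nat (fib m.+4.+1) < 4 * Z.of_nat (fib m.+4.+1))%Z by nia.
  have : lucas s <= lucas m.+4 by apply: leq_lucas; lia.
  lia.
have {Q1} [q|[q|q]] : (Q = 1 \/ Q = 2 \/ Q = 3)%Z by lia.
all: subst Q.
all: case: C => [[hr [hs|hs]]|[hr [hs|hs]]|[hr hs]|[hr hs]].
all: try subst r; try subst s.
all: lia.
Qed.

Lemma odd_eq_of_fib_dvd m n k c : 8 < m -> lucas n = fib m * c + lucas k ->
  odd n = odd k.
Proof.
move=> m8 E.
have m0 : 0 < m by lia.
have [r [q [e [rm odr e1 Er]]]] := @lucas_mod_fib m n m0.
have [r2 [q2 [e2 [rm2 odr2 f1 Er2]]]] := @lucas_mod_fib m k m0.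
apply/eqP; apply/negPn/negP; rewrite -odr -odr2 => no.
have E2 : (Z.of_nat (lucas n) = Z.of_nat (fib m) * Z.of_nat c +
  Z.of_nat (lucas k))%Z by lia.
have [h|h|h] := ltngtP r r2; last by rewrite h eqxx in no.
(* Multiplying by the sign of the larger term, its own inverse, makes that coefficient 1. *)
- apply: (@lucas_comb_mod_fib m r2 r (e2 * (q - q2 - Z.of_nat c)) (- e * e2)) => //.
  + by rewrite h.
  + by rewrite eq_sym.
  + nia.
  + have : (e2 * (e2 * Z.of_nat (lucas r2)) = Z.of_nat (lucas r2))%Z.
      by rewrite Z.mul_assoc f1 Z.mul_1_l.
    have -> : (e2 * Z.of_nat (lucas r2) = Z.of_nat (fib m) *
      (q - q2 - Z.of_nat c) + e * Z.of_nat (lucas r))%Z by lia.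
    by move<-; ring.
- apply: (@lucas_comb_mod_fib m r r2 (e * (q2 - q + Z.of_nat c)) (- e * e2)) => //.
  + by rewrite h.
  + nia.
  + have : (e * (e * Z.of_nat (lucas r)) = Z.of_nat (lucas r))%Z.
      by rewrite Z.mul_assoc e1 Z.mul_1_l.
    have -> : (e * Z.of_nat (lucas r) = Z.of_nat (fib m) *
      (q2 - q + Z.of_nat c) + e2 * Z.of_nat (lucas r2))%Z by lia.
    by move<-; ring.
Qed.

(** * Lifting the exponent for Fibonacci numbers *)

Lemma coprime_fib n : coprime (fib n) (fib n.+1).
Proof.
elim: n => [|n IH]; first by rewrite fib0 fib1.
by rewrite fibSS /coprime gcdnDl gcdnC.
Qed.

(* Modulo [F_M^2], [F_(M t)] is [t F_M F_(M-1)^(t-1)]; here multiplied by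
   [F_(M-1)] to avoid a truncated exponent. *)
Lemma fib_mul_mod_sqr M t : exists w,
  fib (M.+1 * t) * fib M = t * fib M.+1 * fib M ^ t + fib M.+1 ^ 2 * w.
Proof.
(* The induction must also carry the next Fibonacci number, modulo [F_(M+1)] only. *)
suff [w [w1 [-> _]]] : exists w w1,
    fib (M.+1 * t) * fib M = t * fib M.+1 * fib M ^ t + fib M.+1 ^ 2 * w /\
    fib (M.+1 * t).+1 = fib M ^ t + fib M.+1 * w1 by exists w.
elim: t => [|t [w [w1 [E1 E2]]]].
  by exists 0, 0; rewrite !muln0 fib0 fib1.
exists (fib M * (w1 + w)), (fib (M.+1 * t).+1 + fib M * w1 + fib (M.+1 * t)).
have -> : M.+1 * t.+1 = (M.+1 * t + M).+1 by rewrite mulnS; lia.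
split.
  rewrite fibD; transitivity (fib (M.+1 * t).+1 * fib M.+1 * fib M +
    fib (M.+1 * t) * fib M * fib M); first by ring.
  by rewrite E1 E2 (expnS (fib M) t); ring.
rewrite -addnS fibD fibSS.
transitivity (fib M * fib (M.+1 * t).+1 +
  fib M.+1 * (fib (M.+1 * t).+1 + fib (M.+1 * t))); first by ring.
by rewrite {1}E2 (expnS (fib M) t); ring.
Qed.

Lemma fib_dvd M t : fib M %| fib (M * t).
Proof.
case: M => [|M]; first by rewrite mul0n fib0.
have [w E] := fib_mul_mod_sqr M t.
rewrite -(@Gauss_dvdl _ _ (fib M)); last by rewrite coprime_sym coprime_fib.
rewrite E dvdn_add //; first by rewrite dvdn_mulr // dvdn_mull.
by rewrite dvdn_mulr // dvdn_exp.
Qed.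

Section Lifting.
Variables p M c : nat.
Hypotheses (pp : prime p) (c1 : 1 < c) (M0 : 0 < M).
Hypothesis base : forall N, p ^ c %| fib N -> M %| N.
Hypothesis exact1 : p ^ c %| fib M.
Hypothesis exact2 : ~~ (p ^ c.+1 %| fib M).

(** [M] is the rank of apparition of [p^c]; [Mp i] will be that of [p^(c+i)]. *)
Let Mp i := M * p ^ i.

(** Raising the index by a factor [p] gains exactly one [p]: the error term is [p^(e-1)] times a
    multiple of [p^(e+1)], and [c > 1] keeps [e - 1] positive. *)
Lemma fib_exact i :
  p ^ (c + i) %| fib (Mp i) /\ ~~ (p ^ (c + i).+1 %| fib (Mp i)).
Proof.
elim: i => [|i [IH1 IH2]]; first by rewrite addn0 /Mp muln1.
set e := c + i in IH1 IH2 *.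
have e1 : 1 < e := leq_trans c1 (leq_addr i c).
have Mi0 : 0 < Mp i by rewrite muln_gt0 M0 expn_gt0 prime_gt0.
have [w E] := fib_mul_mod_sqr (Mp i).-1 p.
move: E; rewrite prednK //.
set u := fib _.-1 => E.
have pu : coprime p u.
  have := coprime_fib (Mp i).-1; rewrite prednK // -/u coprime_sym.
  apply: coprime_dvdl; apply: dvdn_trans IH1.
  by rewrite -{1}(expn1 p) dvdn_exp2l // ltnW.
have [a Ea] := dvdnP IH1.
have pa : ~~ (p %| a).
  by apply: contra IH2 => /dvdnP[a2 Ea2]; rewrite Ea Ea2 -mulnA -expnS dvdn_mull.
have -> : Mp i.+1 = Mp i * p by rewrite /Mp expnSr mulnA.
have E2 : fib (Mp i * p) * u = p ^ e.+1 * (a * u ^ p + p ^ e.-1 * (a ^ 2 * w)).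
  rewrite E Ea; case: (e) e1 => // e2 _; rewrite /= (expnS p e2.+1) (expnS p e2).
  by ring.
rewrite addnS -/e; split.
  rewrite -(@Gauss_dvdl _ _ u); last by rewrite coprimeXl.
  by rewrite E2 dvdn_mulr.
rewrite -(@Gauss_dvdl _ _ u); last by rewrite coprimeXl.
rewrite E2 (expnSr p e.+1) dvdn_pmul2l ?expn_gt0 ?prime_gt0 //.
rewrite dvdn_addl; last first.
  by rewrite dvdn_mulr // -{1}(expn1 p) dvdn_exp2l // -ltnS prednK // ltnW.
by rewrite Gauss_dvdl // coprimeXr.
Qed.

(** Write [N = t * Mp i]: once [p^e] is cancelled, the cofactor is [t a u^t] modulo [p], with [a]
    and [u] prime to [p], so [p] divides [t]. *)
Lemma fib_rank i N : p ^ (c + i) %| fib N -> Mp i %| N.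
Proof.
elim: i N => [|i IH] N; first by rewrite addn0 /Mp muln1; exact: base.
have [X1 X2] := fib_exact i.
rewrite addnS => d; have /IH/dvdnP[t Et] : p ^ (c + i) %| fib N.
  by apply: dvdn_trans d; rewrite dvdn_exp2l.
set e := c + i in d X1 X2 *.
have e0 : 0 < e := leq_trans (ltnW c1) (leq_addr i c).
have Mi0 : 0 < Mp i by rewrite muln_gt0 M0 expn_gt0 prime_gt0.
have [w E] := fib_mul_mod_sqr (Mp i).-1 t.
move: E; rewrite prednK // [Mp i * t]mulnC -Et [fib N * _]mulnC.
set u := fib _.-1 => E.
have pu : coprime p u.
  have := coprime_fib (Mp i).-1; rewrite prednK // -/u coprime_sym.
  apply: coprime_dvdl; apply: dvdn_trans X1.
  by rewrite -{1}(expn1 p) dvdn_exp2l.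
have [a Ea] := dvdnP X1.
have pa : ~~ (p %| a).
  by apply: contra X2 => /dvdnP[a2 Ea2]; rewrite Ea Ea2 -mulnA -expnS dvdn_mull.
have : p ^ e.+1 %| u * fib N by rewrite dvdn_mull.
have -> : u * fib N = p ^ e * (t * a * u ^ t + p ^ e * (a ^ 2 * w)).
  by rewrite E Ea; ring.
rewrite expnSr dvdn_pmul2l ?expn_gt0 ?prime_gt0 // dvdn_addl; last first.
  by rewrite dvdn_mulr // -{1}(expn1 p) dvdn_exp2l.
rewrite Gauss_dvdl ?coprimeXr // Gauss_dvdl; last by rewrite prime_coprime.
move=> pt; rewrite Et /Mp expnSr mulnA mulnC [M * _]mulnC.
by rewrite dvdn_mul // mulnC.
Qed.

Lemma expn_dvd_fib_leq e N : 0 < N -> p ^ e %| fib N -> p ^ e <= p ^ c * N.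
Proof.
move=> N0; have [ec|ce] := leqP e c => d.
  by rewrite -[p ^ e]muln1 leq_mul // leq_exp2l // prime_gt1.
have E : e = c + (e - c) by rewrite subnKC // ltnW.
move: d; rewrite E => /fib_rank/dvdn_leq => /(_ N0) h.
rewrite expnD leq_mul2l; apply/orP; right; apply: leq_trans h.
by rewrite leq_pmull.
Qed.

End Lifting.

(** * Ranks of apparition, and the case of equal parity *)

Definition step M (z : nat * nat) := (z.2, (z.1 + z.2) %% M).

Lemma iter_step (u : nat -> nat) M n :
  (forall i, u i.+2 = u i.+1 + u i) ->
  iter n (step M) (u 0 %% M, u 1 %% M) = (u n %% M, u n.+1 %% M).
Proof.
by move=> uSS; elim: n => //= n ->; rewrite /step /= modnDm uSS addnC.
Qed.

(** For [r > 0], tests that [r] is the rank of apparition of [M]. *)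
Definition rank_check M r :=
  ((iter r (step M) (0 %% M, 1 %% M)).1 == 0) &&
  all (fun i => (iter i (step M) (0 %% M, 1 %% M)).1 != 0) (iota 1 r.-1).

Lemma rank_checkP M r N : 0 < r -> rank_check M r -> M %| fib N -> r %| N.
Proof.
move=> r0 /andP[]; rewrite (iter_step fib M r fibSS) => /= Mr /allP h.
rewrite (divn_eq N r); case: (posnP (N %% r)) => [->|i0].
  by rewrite addn0 dvdn_mull.
move: (ltn_pmod N r0) i0; case: (N %% r) => // i ir _.
rewrite addnS fibD => d; exfalso.
have d1 : M %| fib (N %/ r * r).
  by apply: dvdn_trans Mr _; rewrite mulnC fib_dvd.
have cM : coprime M (fib (N %/ r * r).+1).
  by apply: coprime_dvdl d1 (coprime_fib _).
move: d; rewrite dvdn_addl; last exact: dvdn_mulr.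
rewrite Gauss_dvdr // => d.
have := h i.+1; rewrite mem_iota (iter_step fib _ _ fibSS) /= -/(dvdn _ _) d.
by move=> /(_ _)/negP; apply => //; lia.
Qed.

(** Lifting starts from [8 | F_6], [9 | F_12], [25 | F_25], [49 | F_56]. For [p = 2] the start
    [c = 2] fails: the rank of 4 is 6, and [F_6 = 8]. *)
Lemma expn_dvd_fib_bound p e N : p \in [:: 2; 3; 5; 7] -> 0 < N ->
  p ^ e %| fib N -> p ^ e <= (if p == 2 then 8 else p ^ 2) * N.
Proof.
have X M r : (iter r (step M) (0 %% M, 1 %% M)).1 != 0 -> ~~ (M %| fib r).
  by rewrite (iter_step fib _ _ fibSS).
have Y M r : (iter r (step M) (0 %% M, 1 %% M)).1 == 0 -> M %| fib r.
  by rewrite (iter_step fib _ _ fibSS).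
have Z M r : 0 < r -> rank_check M r -> forall n, M %| fib n -> r %| n.
  by move=> r0 h n; apply: rank_checkP.
rewrite !inE => /or4P[] /eqP-> N0.
- exact: (expn_dvd_fib_leq 2 6 3 isT isT isT (Z (2 ^ 3) 6 isT isT)
    (Y (2 ^ 3) 6 isT) (X (2 ^ 4) 6 isT)).
- exact: (expn_dvd_fib_leq 3 12 2 isT isT isT (Z (3 ^ 2) 12 isT isT)
    (Y (3 ^ 2) 12 isT) (X (3 ^ 3) 12 isT)).
- exact: (expn_dvd_fib_leq 5 25 2 isT isT isT (Z (5 ^ 2) 25 isT isT)
    (Y (5 ^ 2) 25 isT) (X (5 ^ 3) 25 isT)).
- exact: (expn_dvd_fib_leq 7 56 2 isT isT isT (Z (7 ^ 2) 56 isT isT)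
    (Y (7 ^ 2) 56 isT) (X (7 ^ 3) 56 isT)).
Qed.

(** With [n = k + 2v], [c] is [5 F_(k+v) F_v] or [L_(k+v) L_v], by the parity of [v]; both divide
    the target since [F_(2x) = F_x L_x]. *)
Lemma dvd_lucas_sub n k c : k < n -> odd n = odd k ->
  lucas n = c + lucas k -> c %| 5 * fib (n + k) * fib (n - k).
Proof.
move=> kn o E.
have [v Ev] : exists v, n = k + v + v.
  by exists (n - k)./2; have := odd_double_half (n - k); rewrite oddB 1?ltnW //
    o addbb -addnn; lia.
have -> : n + k = (k + v) + (k + v) by lia.
have -> : n - k = v + v by lia.
rewrite !fib_double.
have [ov|ov] := boolP (odd v).
  have := @lucas_sub_lucas k v ov; rewrite -Ev E => /addIn ->.
  by apply/dvdnP; exists (5 * fib (k + v) * fib v); ring.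
have := lucas_sub_fib k v; rewrite -Ev E (negbTE ov) mul0n addn0 mul1n.
move=> /addIn ->.
by apply/dvdnP; exists (lucas (k + v) * lucas v); ring.
Qed.

Lemma expn_dvd_lucas_sub p e n k c : p \in [:: 2; 3; 5; 7] ->
  k < n -> odd n = odd k -> lucas n = c + lucas k -> p ^ e %| c ->
  p ^ e <= 5 * (if p == 2 then 8 else p ^ 2) ^ 2 * ((n + k) * (n - k)).
Proof.
move=> hp kn o E d.
have pp : prime p by move: hp; rewrite !inE => /or4P[] /eqP->.
have := dvdn_trans d (@dvd_lucas_sub n k c kn o E).
have F1 : 0 < fib (n + k) by apply: fib_gt0; lia.
have F2 : 0 < fib (n - k) by apply: fib_gt0; lia.
rewrite pfactor_dvdn ?muln_gt0 ?F1 ?F2 // !lognM // ?muln_gt0 ?F1 // => h.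
have := leq_pexp2l (prime_gt0 pp) h; rewrite !expnD => /leq_trans; apply.
have N1 : 0 < n + k by lia.
have N2 : 0 < n - k by lia.
have B1 := @expn_dvd_fib_bound p _ _ hp N1 (pfactor_dvdnn p (fib (n + k))).
have B2 := @expn_dvd_fib_bound p _ _ hp N2 (pfactor_dvdnn p (fib (n - k))).
have B3 : p ^ logn p 5 <= 5 by apply: dvdn_leq => //; apply: pfactor_dvdnn.
apply: leq_trans (leq_mul (leq_mul B3 B1) B2) _.
by rewrite -mulnn; apply: eq_leq; ring.
Qed.

(** The factors are the later bounds on [n + k] and [n - k]; from [d] to [d + 1] their product at
    most doubles. *)
Lemma quad_lt_exp q a D d : 1 < q -> 2 < D <= d ->
  a * ((20 * D + 14) * (10 * D + 14)) < q ^ D ->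
  a * ((20 * d + 14) * (10 * d + 14)) < q ^ d.
Proof.
move=> q1 /andP[D2 Dd] h.
elim: d Dd => [|d IH]; first by lia.
rewrite leq_eqVlt => /orP[/eqP<- //|Dd]; rewrite ltnS in Dd.
apply: (@leq_ltn_trans (2 * (a * ((20 * d + 14) * (10 * d + 14))))).
  by rewrite [leqRHS]mulnCA leq_mul2l; apply/orP; right; nia.
by rewrite expnS; have := IH Dd; nia.
Qed.

(* From here on a power [q^d] of a suitable prime power [q | b] beats the
   quadratic bound of [expn_dvd_lucas_sub]. *)
Definition cutoff b := if b == 2 then 26 else 16.

Lemma same_parity_cutoff b d n k c : 2 <= b <= 10 -> k < n -> odd n = odd k ->
  lucas n = c * b ^ d + lucas k ->
  n + k <= 20 * d + 14 -> n - k <= 10 * d + 14 -> d < cutoff b.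
Proof.
move=> hb kn o E h1 h2; rewrite ltnNge; apply/negP => Dd.
have X p v C D : p \in [:: 2; 3; 5; 7] -> p ^ v %| b -> 0 < v ->
  (if p == 2 then 8 else p ^ 2) = C -> cutoff b = D ->
  5 * C ^ 2 * ((20 * D + 14) * (10 * D + 14)) < (p ^ v) ^ D -> False.
  move=> hp pv v0 <- <- lt.
  have pd : p ^ (v * d) %| c * b ^ d by rewrite expnM dvdn_mull // dvdn_exp2r.
  have := expn_dvd_lucas_sub p (v * d) n k _ hp kn o E pd.
  rewrite expnM leqNgt => /negP; apply.
  apply: leq_ltn_trans (quad_lt_exp (p ^ v) _ (cutoff b) d _ _ lt).
  - by rewrite leq_mul2l; apply/orP; right; apply: leq_mul.
  - rewrite -(exp1n v) ltn_exp2r //.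
    by move: hp; rewrite !inE => /or4P[] /eqP->.
  - by rewrite Dd andbT /cutoff; case: ifP.
have : b \in iota 2 9 by rewrite mem_iota; lia.
rewrite !inE => /orP[/eqP eb|/orP[/eqP eb|/orP[/eqP eb|/orP[/eqP eb|/orP[/eqP eb|
  /orP[/eqP eb|/orP[/eqP eb|/orP[/eqP eb|/eqP eb]]]]]]]]; rewrite eb in X.
(* The numbers are [p], [v], [C], [D]; bases 6 and 10 use their larger prime, whose powers grow
   faster. *)
- by apply: (X 2 1 8 26 isT isT isT erefl erefl); clear; lia.
- by apply: (X 3 1 9 16 isT isT isT erefl erefl); clear; lia.
- by apply: (X 2 2 8 16 isT isT isT erefl erefl); clear; lia.
- by apply: (X 5 1 25 16 isT isT isT erefl erefl); clear; lia.
- by apply: (X 3 1 9 16 isT isT isT erefl erefl); clear; lia.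
- by apply: (X 7 1 49 16 isT isT isT erefl erefl); clear; lia.
- by apply: (X 2 3 8 16 isT isT isT erefl erefl); clear; lia.
- by apply: (X 3 2 9 16 isT isT isT erefl erefl); clear; lia.
- by apply: (X 5 1 25 16 isT isT isT erefl erefl); clear; lia.
Qed.

(** * Size bounds on [m], [k] and [j = n - m] *)

Section Bounds.
Variables n m k b d : nat.
Hypotheses (b2 : 2 <= b <= 10) (m0 : 0 < m).
Hypotheses (ltB : lucas k < b ^ d) (leB : b ^ d <= b * lucas k).
Hypothesis E : lucas n = fib m * b ^ d + lucas k.

Lemma leq_m_n : m <= n.
Proof.
rewrite leqNgt; apply/negP => nm.
have := leq_fib n.+1 m nm; have := lucas_fib n; have := lucas_gt0 k.
have l0 := lucas_gt0 k.
have : fib m * 2 <= fib m * b ^ d by rewrite leq_mul2l; apply/orP; right; lia.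
by move: E; lia.
Qed.

Let j := n - m.

Lemma lucas_split : lucas n = fib m * lucas j.+1 + fib m.-1 * lucas j.
Proof.
have -> : n = (m.-1 + j).+1 by have := leq_m_n; rewrite /j; lia.
by rewrite lucasD prednK.
Qed.

(** In [lucas_split], [0 <= F_(m-1) <= F_m] places [L_n] between [F_m L_(j+1)] and [F_m L_(j+2)];
    this and [bound_j2] compare it with [F_m b^d]. *)
Lemma bound_j1 : b ^ d < lucas j.+2.
Proof.
have f0 := fib_gt0 m m0; have f1 := leq_fib m.-1 m (leq_pred m).
have h : fib m.-1 * lucas j <= fib m * lucas j by rewrite leq_mul2r f1 orbT.
rewrite -(ltn_pmul2l f0) lucasSS mulnDr.
by move: (lucas_gt0 k) lucas_split E; lia.
Qed.

Lemma bound_j2 : lucas j.+1 < 2 * b ^ d.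
Proof.
have f0 := fib_gt0 m m0.
have h : b ^ d <= fib m * b ^ d by rewrite leq_pmull.
rewrite -(ltn_pmul2l f0) mulnCA.
by move: lucas_split E ltB; lia.
Qed.

Lemma bound_j3 : k <= j.+1.
Proof.
rewrite leqNgt; apply/negP => jk.
have k1 : 1 < k by lia.
by move: (leq_lucas j.+2 k k1 jk) bound_j1 ltB; lia.
Qed.

(** Otherwise [L_(j+1) >= L_(k+8) = 21 L_(k+1) + 13 L_k > 20 L_k >= 2 b^d]. *)
Lemma bound_j4 : j <= k + 6.
Proof.
rewrite leqNgt; apply/negP => jk.
have h : lucas (7 + k).+1 <= lucas j.+1 by apply: leq_lucas; lia.
have h1 : b * lucas k <= 10 * lucas k by rewrite leq_mul2r; case/andP: b2 => _ ->; rewrite orbT.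
move: h; rewrite lucasD.
have -> : fib 8 = 21 by []. 
have -> : fib 7 = 13 by [].
have h2 : lucas k <= 2 * lucas k.+1.
  by case: (k) => // k1; rewrite lucasSS; lia.
move: bound_j2 leB (lucas_gt0 k) h1 h2.
case: (k) => [|k1]; first by rewrite lucas0 lucas1; lia.
by rewrite lucasSS; lia.
Qed.

(** Otherwise, with [u = m - j], [F_m (b^d - 5 F_j) = (-1)^j L_u - L_k] is nonzero and of absolute
    value below [L_(u+1) <= F_(u+3) <= F_m]. *)
Lemma bound_m1 : 2 < j -> m <= j + k + 2.
Proof.
move=> j3; rewrite leqNgt; apply/negP => jm.
have mn := leq_m_n.
set u := m - j.
have := lucas_sub_fib u j.
have -> : u + j = m by rewrite /u; lia.
have -> : m + j = n by rewrite /j; lia.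
have h1 : lucas k < lucas u.-1 by apply: ltn_lucas; rewrite /u; lia.
have h2 : lucas u.+1 = lucas u + lucas u.-1.
  by have -> : u = u.-1.+1 by [rewrite /u; lia]; rewrite lucasSS.
have h3 := lucas_fib u.+1.
have h4 : fib u.+3 <= fib m by apply: leq_fib; rewrite /u; lia.
have h5 := fibSS u; have h6 := fibSS u.+1; have h9 := leq_fib u u.+1 (leqnSn u).
have h8 : lucas u.-1 < lucas u by apply: ltn_lucas; rewrite /u; lia.
have [h7|[h7|h7]] : b ^ d = 5 * fib j \/ (b ^ d).+1 <= 5 * fib j \/
  (5 * fib j).+1 <= b ^ d by lia.
- by move: E; rewrite h7; case: (odd j) => /=; lia.
- have : fib m * (b ^ d).+1 <= fib m * (5 * fib j) by rewrite leq_mul2l h7 orbT.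
  by move: E; case: (odd j) => /=; lia.
- have : fib m * (5 * fib j).+1 <= fib m * b ^ d by rewrite leq_mul2l h7 orbT.
  by move: E; case: (odd j) => /=; lia.
Qed.

(** Here [b^d < L_4 = 7]; if [m > 8], each possible [b^d] makes [L_n - F_m b^d] negative or at least
    7, hence not [L_k]. *)
Lemma bound_m2 : j <= 2 -> m <= 8.
Proof.
move=> j2; rewrite leqNgt; apply/negP => m8.
have [a Ea] : exists a, m = a.+4 by exists (m - 4); lia.
have h1 : fib 5 <= fib a by apply: leq_fib; lia.
have h2 : fib 6 <= fib a.+1 by apply: leq_fib; lia.
have {}h1 : 5 <= fib a := h1.
have {}h2 : 8 <= fib a.+1 := h2.
move: lucas_split bound_j1 ltB (lucas_gt0 k); rewrite E Ea /=.
move: (fibSS a.+2) (fibSS a.+1) (fibSS a) => -> -> ->.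
have -> : lucas j.+2 = lucas j.+1 + lucas j by rewrite lucasSS.
move: (b ^ d) (lucas k) (fib a) (fib a.+1) h1 h2 => B l x y h1 h2.
have [->|[->|->]] : j = 0 \/ j = 1 \/ j = 2 by lia.
- have [-> ->] : lucas 1 = 1 /\ lucas 0 = 2 by [].
  nia.
- have [-> ->] : lucas 2 = 3 /\ lucas 1 = 1 by [].
  nia.
- have [-> ->] : lucas 3 = 4 /\ lucas 2 = 3 by [].
  move=> e1 e2 e3 e4.
  have [hB|[hB|[hB|[hB|[hB|hB]]]]] : B = 1 \/ B = 2 \/ B = 3 \/ B = 4 \/ B = 5 \/ B = 6 by lia.
  all: subst B; lia.
Qed.

(** Five indices multiply a Lucas number by about [phi^5 > 11]. *)
Lemma exp10_leq_lucas e : 10 ^ e <= lucas (5 * e).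
Proof.
elim: e => // e IH; rewrite expnS mulnS addnC.
have -> : lucas (5 * e + 5) = 5 * lucas (5 * e).+1 + 3 * lucas (5 * e).
  by rewrite -[5]/((4).+1) addnS addnC lucasD.
case: e IH => // e; rewrite mulnS.
move: (5 * e) => i; rewrite !addSn add0n.
move: (lucasSS i.+1) (lucasSS i.+2) (lucasSS i.+3) (lucasSS i.+4); lia.
Qed.

Lemma bound_k : k < 5 * d.
Proof.
have d0 : 0 < d.
  by case: (d) ltB => //; rewrite expn0; move: (lucas_gt0 k); lia.
rewrite ltnNge; apply/negP => dk.
have h1 : lucas (5 * d) <= lucas k by apply: leq_lucas; lia.
have h2 : b ^ d <= 10 ^ d by rewrite leq_exp2r //; case/andP: b2.
by move: (exp10_leq_lucas d) ltB; lia.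
Qed.

(** For [j > 2], [m + j + k <= 2j + 2k + 2 <= 4k + 14] with [k < 5d]; [bound_sub] likewise uses
    [2j + 2 <= 2k + 14]. *)
Lemma bound_add : n + k <= 20 * d + 14.
Proof.
have mn := leq_m_n; have := bound_k; have := bound_j4; have := bound_j3.
have [h|h] := leqP j 2; [have := bound_m2 h | have := bound_m1 h];
  by rewrite /j in h *; lia.
Qed.

Lemma bound_sub : n - k <= 10 * d + 14.
Proof.
have mn := leq_m_n; have := bound_k; have := bound_j4; have := bound_j3.
have [h|h] := leqP j 2; [have := bound_m2 h | have := bound_m1 h];
  by rewrite /j in h *; lia.
Qed.

End Bounds.

(** * Finite search below the cutoff *)

(* Early exit: two consecutive terms above [t >= 0], or two negative ones,
   force all later terms of a Fibonacci-like sequence to differ from [t]. *)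
Fixpoint scan (ok : nat -> bool) (t x y : Z) (m fuel : nat) : bool :=
  if fuel is f.+1 then
    if (if Z.eqb x t then ok m else true) then
      if ((t <? x) && (t <? y) || (x <? 0) && (y <? 0))%Z then true
      else scan ok t y (x + y)%Z m.+1 f
    else false
  else true.

Lemma scanP ok t (u : nat -> Z) m f : (0 <= t)%Z ->
  (forall i, u i.+2 = u i.+1 + u i)%Z -> scan ok t (u m) (u m.+1) m f ->
  forall i, i < f -> u (m + i) = t -> ok (m + i).
Proof.
move=> t0 uSS; elim: f m => [|f IH] m //=.
have [um|um] := Z.eqb_spec (u m) t.
  case: ifP => // okm; case: ifP => [st _|_ h].
    by case=> [|i] _; [rewrite addn0|move: st; rewrite um; lia].
  case=> [|i] lt; first by rewrite addn0.
  by rewrite addnS -addSn; apply: IH => //; rewrite uSS Z.add_comm.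
case: ifP => [st _|_ h]; last first.
  case=> [|i] lt; first by rewrite addn0.
  by rewrite addnS -addSn; apply: IH => //; rewrite uSS Z.add_comm.
move=> i _ ui; exfalso.
have [[a1 a2]|[a1 a2]] : (t < u m /\ t < u m.+1 \/ u m < 0 /\ u m.+1 < 0)%Z.
    by lia.
  suff: (t < u (m + i)%nat /\ t < u (m + i).+1)%Z by lia.
  elim: i {ui} => [|i [IH1 IH2]]; first by rewrite addn0.
  by rewrite addnS uSS; lia.
suff: (u (m + i)%nat < 0 /\ u (m + i).+1 < 0)%Z by lia.
elim: i {ui} => [|i [IH1 IH2]]; first by rewrite addn0.
by rewrite addnS uSS; lia.
Qed.

Definition zlucas n := (ssrnat.iter n (fun z : Z * Z => (z.2, z.1 + z.2)%Z) (2, 1)%Z).1.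

Lemma zlucasE n : zlucas n = Z.of_nat (lucas n).
Proof.
suff: ssrnat.iter n (fun z : Z * Z => (z.2, z.1 + z.2)%Z) (2, 1)%Z =
  (Z.of_nat (lucas n), Z.of_nat (lucas n.+1)) by rewrite /zlucas => ->.
by elim: n => //= n ->; rewrite lucasSS /=; congr (_, _); lia.
Qed.

(** The list of [j] covers [k - 1 <= j <= k + 6]; the fuel covers both bounds on [m]. [T] tabulates
    Lucas numbers once. *)
Definition finite_check (T : seq Z) b d k :=
  let L := nth 0%Z T in
  let t := L k in let B := (Z.of_nat b ^ Z.of_nat d)%Z in
  if ((t <? B) && (B <=? Z.of_nat b * t))%Z then
    all (fun j => if ((B <? L j.+2) && (L j.+1 <? 2 * B))%Z
      then scan (fun m => (m + j, m, k, b, d) \in solutions) t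
        (L j.+1 - B)%Z (L j.+2 - B)%Z 1 (j + k + 8)
      else true) (iota k.-1 8)
  else true.

(** Since [d <= 25], one has [k <= 124], [j <= 130], and indices stay below 140. *)
Lemma finite_checkT :
  let T := mkseq zlucas 140 in
  all (fun b => all (fun d => all (finite_check T b d) (iota 0 (5 * d)))
    (iota 1 (cutoff b).-1)) (iota 2 9).
Proof. by vm_compute. Qed.

Lemma finite_checkP b d k j m : 2 <= b <= 10 -> 0 < d < cutoff b ->
  k < 5 * d -> lucas k < b ^ d -> b ^ d <= b * lucas k ->
  k <= j.+1 -> j <= k + 6 -> b ^ d < lucas j.+2 -> lucas j.+1 < 2 * b ^ d ->
  0 < m <= j + k + 8 ->
  lucas (m + j) = fib m * b ^ d + lucas k ->
  (m + j, m, k, b, d) \in solutions.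
Proof.
move=> hb hd hk h1 h2 h3 h4 h5 h6 /andP[m0 hm] E.
have c26 : cutoff b <= 26 by rewrite /cutoff; case: ifP.
have /allP/(_ b) := finite_checkT.
rewrite mem_iota => /(_ _)/allP/(_ d); rewrite mem_iota.
move=> /(_ ltac:(lia) ltac:(lia))/allP/(_ k).
rewrite mem_iota => /(_ ltac:(lia)); rewrite /finite_check.
have LE i : i < 140 -> nth 0%Z (mkseq zlucas 140) i = Z.of_nat (lucas i).
  by move=> lt; rewrite nth_mkseq // zlucasE.
rewrite LE; last by lia.
have -> : (Z.of_nat b ^ Z.of_nat d)%Z = Z.of_nat (b ^ d).
  elim: (d) => [|e IH]; first by rewrite expn0.
  by rewrite Nat2Z.inj_succ Z.pow_succ_r ?IH ?expnS; lia.
case: ifP => [_|]; last by lia.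
move=> /allP/(_ j); rewrite mem_iota => /(_ ltac:(lia)).
rewrite !LE; try by lia.
case: ifP => [_|]; last by lia.
pose u i := (Z.of_nat (lucas (i + j)) - Z.of_nat (fib i * b ^ d))%Z.
have -> : (Z.of_nat (lucas j.+1) - Z.of_nat (b ^ d))%Z = u 1.
  by rewrite /u fib1 mul1n.
have -> : (Z.of_nat (lucas j.+2) - Z.of_nat (b ^ d))%Z = u 2.
  by rewrite /u mul1n.
have t0 : (0 <= Z.of_nat (lucas k))%Z by lia.
have uSS i : u i.+2 = (u i.+1 + u i)%Z.
  by rewrite /u fibSS !addSn lucasSS mulnDl; lia.
(* The scan starts at index 1, so [m] is at offset [m - 1]. *)
move=> h; have := scanP _ _ u 1 _ t0 uSS h m.-1.
rewrite add1n prednK //; apply; first by lia.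
by rewrite /u E; lia.
Qed.

(** * Congruence sieve for the case of opposite parity *)

Definition lucas_mods M s := [seq z.1 | z <- traject (step M) (2 %% M, 1 %% M) s].

Lemma nth_lucas_mods M s i : i < s -> nth 0 (lucas_mods M s) i = lucas i %% M.
Proof.
move=> lt; rewrite (nth_map (2 %% M, 1 %% M)) ?size_traject // nth_traject //.
by rewrite (iter_step lucas M i lucasSS).
Qed.

Definition periodic M P := iter P (step M) (2 %% M, 1 %% M) == (2 %% M, 1 %% M).

Lemma lucas_modP M P i k : periodic M P -> lucas (i + k * P) = lucas i %[mod M].
Proof.
move=> /eqP h; suff: iter (i + k * P) (step M) (2 %% M, 1 %% M) =
  iter i (step M) (2 %% M, 1 %% M).
  by rewrite !(iter_step lucas M _ lucasSS) => -[].
rewrite iterD; congr iter; elim: k => // k IH.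
by rewrite mulSn iterD IH.
Qed.

(* A row [(b, e, l, P, o)] refutes [lucas (k + t) = f * b ^ d + lucas k] for
   [e <= d]: [P] is a common period of [lucas] modulo [b ^ e] and [l], and [o]
   one of the powers of [b] modulo [l]; every residue of [k] modulo [P] that
   fits modulo [b ^ e] fails modulo [l]. *)
Definition sieve (c : nat * nat * nat * nat * nat) (t f : nat) :=
  let: (b, e, l, P, o) := c in
  let A := lucas_mods (b ^ e) (P + t) in
  let B := lucas_mods l (P + t) in
  let mulb x := x * b %% l in
  let H := traject mulb (f %% l) o in
  [&& periodic (b ^ e) P, periodic l P, iter o mulb (1 %% l) == 1 %% l, 0 < P, 0 < o
  & all (fun k => if nth 0 A (k + t) == nth 0 A k
      then all (fun h => (nth 0 B k + h) %% l != nth 0 B (k + t)) H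
      else true) (iota 0 P)].

Lemma sieveP b e l P o t f k d : sieve (b, e, l, P, o) t f -> e <= d ->
  lucas (k + t) <> f * b ^ d + lucas k.
Proof.
move=> /and5P[p1 p2 /eqP bo P0 /andP[o0 /allP h]] ed E.
have IT x i : iter i (fun x => x * b %% l) (x %% l) = x * b ^ i %% l.
  elim: i => [|i IH]; first by rewrite muln1.
  by rewrite iterS IH modnMml expnSr mulnA.
rewrite IT mul1n in bo.
have kP : k %% P < P by rewrite ltn_mod.
have := h (k %% P); rewrite mem_iota kP => /(_ isT).
rewrite !nth_lucas_mods ?ltn_add2r //; try lia.
have Ek M : periodic M P -> lucas k = lucas (k %% P) %[mod M].
  by move=> p; rewrite {1}(divn_eq k P) addnC lucas_modP.
have Ekt M : periodic M P -> lucas (k + t) = lucas (k %% P + t) %[mod M].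
  move=> p; have -> : k + t = k %% P + t + k %/ P * P.
    by rewrite {1}(divn_eq k P); ring.
  exact: lucas_modP.
rewrite -!Ek // -!Ekt // E -{1}(subnK ed) expnD mulnA modnMDl eqxx.
move=> /allP/(_ ((f * b ^ d) %% l)) /(_ _)/negP; apply; last first.
  by rewrite addnC modnDm.
(* Powers of [b] repeat with period [o] modulo [l], so [d] reduces modulo [o]. *)
have -> : f * b ^ d %% l = iter (d %% o) (fun x => x * b %% l) (f %% l).
  rewrite IT.
  have bq : b ^ (d %/ o * o) = 1 %[mod l].
    by rewrite mulnC expnM -modnXm bo modnXm exp1n.
  by rewrite {1}(divn_eq d o) expnD mulnCA -modnMml bq modnMml mul1n.
by apply/trajectP; exists (d %% o) => //; rewrite ltn_mod.
Qed.

(** In a row with [l = 1] the second test cannot succeed: no [k] at all fits modulo [b^e]. *)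
Definition certificates := [::
  (2, 4, 1, 24, 1); (2, 1, 31, 30, 5); (2, 6, 23, 96, 11); (2, 4, 43, 264, 14);
  (3, 1, 13, 56, 3); (3, 1, 41, 40, 8); (3, 1, 11, 40, 5); (3, 2, 61, 120, 10);
  (4, 1, 17, 36, 4); (4, 2, 1, 24, 1); (4, 3, 1103, 96, 29); (5, 1, 1, 4, 1);
  (6, 2, 1, 24, 1); (6, 2, 19, 72, 9); (6, 3, 1, 72, 1); (7, 2, 29, 112, 7);
  (7, 2, 13, 112, 12); (7, 1, 2161, 80, 432); (8, 2, 23, 96, 11);
  (8, 1, 19, 36, 6); (8, 1, 13, 84, 4); (8, 1, 109, 108, 12);
  (8, 3, 47, 768, 23); (9, 1, 41, 120, 4); (9, 1, 11, 120, 5);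
  (9, 1, 29, 168, 14); (10, 1, 1, 12, 1)].

(* Necessary for [L_(k+t) = f b^d + L_k], as [8/5 <= L_(k+1) / L_k <= 13/8]. *)
Definition admissible b t f := (8 * fib t + 5 * fib t.-1 <= 5 * (b * f + 1)) &&
  (8 * (f + 1) < 13 * fib t + 8 * fib t.-1).

Definition refuted b t f :=
  has (fun c => let: (b', e, _, _, _) := c in
    if (b' == b) && (e <= 6) then sieve c t f else false) certificates.

(** [m <= 8] and [j <= k + 6] leave [t = n - k <= 14]. *)
Lemma refutedT : all (fun b => all (fun t => all (fun m =>
    if odd t && admissible b t (fib m) then refuted b t (fib m) else true)
  (iota 1 8)) (iota 1 14)) (iota 2 9).
Proof. by vm_compute. Qed.

Lemma certificatesP b t f k d : refuted b t f -> 6 <= d ->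
  lucas (k + t) <> f * b ^ d + lucas k.
Proof.
move=> /hasP[[[[[b1 e] l] P] o] _]; case: ifP => // /andP[/eqP-> e6] S d6.
by apply: (sieveP _ _ _ _ _ _ _ _ _ S); apply: leq_trans d6.
Qed.

(** The map [x -> 1 + 1/x] sends [[8/5, 13/8]] into itself, and [L_7 / L_6 = 29/18] lies there. *)
Lemma lucas_ratio k : 6 <= k ->
  (8 * lucas k <= 5 * lucas k.+1) && (8 * lucas k.+1 <= 13 * lucas k).
Proof.
elim: k => // k IH; rewrite leq_eqVlt => /orP[/eqP<-|] //.
by rewrite ltnS => /IH; rewrite lucasSS; lia.
Qed.

(** After division by [L_k] the right side exceeds [F_m + 1] and is at most [b F_m + 1]; the left is
    [F_t L_(k+1) / L_k + F_(t-1)]. *)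
Lemma admissibleT b t k m d : 0 < t -> 6 <= k ->
  lucas k < b ^ d -> b ^ d <= b * lucas k -> 0 < m ->
  lucas (k + t) = fib m * b ^ d + lucas k -> admissible b t (fib m).
Proof.
move=> t0 /lucas_ratio/andP[r1 r2] h1 h2 /fib_gt0 f0 E.
have E1 : lucas (k + t) = fib t * lucas k.+1 + fib t.-1 * lucas k.
  by case: (t) t0 => // s _; rewrite addnS addnC lucasD.
have l0 := lucas_gt0 k.
have g1 : fib m * b ^ d <= fib m * (b * lucas k) by rewrite leq_mul2l h2 orbT.
have g2 : fib m * lucas k < fib m * b ^ d by rewrite ltn_pmul2l.
have g3 : fib t * (8 * lucas k) <= fib t * (5 * lucas k.+1).
  by rewrite leq_mul2l r1 orbT.
have g4 : fib t * (8 * lucas k.+1) <= fib t * (13 * lucas k).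
  by rewrite leq_mul2l r2 orbT.
apply/andP; split.
  by rewrite -(leq_pmul2r l0); lia.
by rewrite -(ltn_pmul2r l0); lia.
Qed.

(** * Bounding [d] in both parity cases, and conclusion *)

Lemma lt_cutoff n m k b d : 2 <= b <= 10 -> 0 < m ->
  lucas k < b ^ d -> b ^ d <= b * lucas k ->
  lucas n = fib m * b ^ d + lucas k -> d < cutoff b.
Proof.
move=> hb m0 h1 h2 E.
have mn := leq_m_n n m k b d hb m0 h1 h2 E.
have j3 := bound_j3 n m k b d hb m0 h1 h2 E.
have j4 := bound_j4 n m k b d hb m0 h1 h2 E.
have Bpos : 0 < fib m * b ^ d.
  by rewrite muln_gt0 fib_gt0 // (leq_trans _ h1).
have nk : n <> k by move=> e; move: E; rewrite e; lia.
have kn : k < n by lia.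
have [o|o] := eqVneq (odd n) (odd k).
  apply: (same_parity_cutoff b d n k (fib m)) => //.
    exact: (bound_add n m k b d).
  exact: (bound_sub n m k b d).
rewrite ltnNge; apply/negP => dc.
have d16 : 16 <= d by apply: leq_trans dc; rewrite /cutoff; case: ifP.
have [m8|m8] := leqP m 8; last first.
  by rewrite (odd_eq_of_fib_dvd m n k (b ^ d)) ?eqxx in o.
(* Otherwise [b^16 <= b^d <= b L_k <= 11 b]. *)
have k6 : 6 <= k.
  rewrite leqNgt; apply/negP => k6.
  have l1 : lucas k <= lucas 5 by apply: leq_lucas; lia.
  have l2 : b ^ 16 <= b ^ d by rewrite leq_exp2l //; case/andP: hb.
  have l3 : 2 ^ 15 <= b ^ 15 by rewrite leq_exp2r //; case/andP: hb.
  have l4 : b * b ^ 15 <= b * lucas k by rewrite -expnS (leq_trans l2).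
  have {}l1 : lucas k <= 11 := l1.
  rewrite leq_pmul2l in l4; last by lia.
  by have := leq_trans l3 (leq_trans l4 l1); clear; lia.
have t0 : 0 < n - k by lia.
have Et : n = k + (n - k) by lia.
rewrite Et in E.
have adm := admissibleT b (n - k) k m d t0 k6 h1 h2 m0 E.
have ot : odd (n - k) by move: o; lia.
have /allP/(_ b) := refutedT; rewrite mem_iota => /(_ ltac:(lia)).
move=> /allP/(_ (n - k)); rewrite mem_iota => /(_ ltac:(lia)).
move=> /allP/(_ m); rewrite mem_iota => /(_ ltac:(lia)); rewrite ot adm /=.
by move=> R; apply: (certificatesP _ _ _ k d R) E; apply: leq_trans d16.
Qed.

Lemma solutionsT : all (fun s => let: (n, m, k, b, d) := s in
  lucas n == fib m * b ^ d + lucas k) solutions.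
Proof. by vm_compute. Qed.

Theorem theorem1p2 (n m k b d : nat) :
  2 <= b <= 10 -> 1 <= m -> d = ndigits b (lucas k) ->
  (lucas n = fib m * b ^ d + lucas k <-> (n, m, k, b, d) \in solutions).
Proof.
move=> hb m0 dE; split=> [E|/(allP solutionsT)/eqP //].
have b1 : 1 < b by case/andP: hb.
have /andP[h1 h2] := trunc_log_bounds b1 (lucas_gt0 k).
have {h2} hlt : lucas k < b ^ d by rewrite dE.
have {h1} hle : b ^ d <= b * lucas k by rewrite dE expnS leq_pmul2l // ltnW.
have mn := leq_m_n n m k b d hb m0 hlt hle E.
have E1 : lucas (m + (n - m)) = fib m * b ^ d + lucas k by rewrite subnKC.
rewrite -(subnKC mn); apply: finite_checkP => //.
- by rewrite (lt_cutoff n m k b d) // andbT dE.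
- exact: (bound_k n m k b d).
- exact: (bound_j3 n m k b d).
- exact: (bound_j4 n m k b d).
- exact: (bound_j1 n m k b d).
- exact: (bound_j2 n m k b d).
(* Both [8] and [j + k + 2] are at most [j + k + 8]. *)
rewrite m0 /=; have [h|h] := leqP (n - m) 2.
  by have := bound_m2 n m k b d hb m0 hlt hle E h; lia.
by have := bound_m1 n m k b d hb m0 hlt hle E h; lia.
Qed.
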